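(* Let $f$ be a differentiable function on $[-1,1]$ with bounded first derivative, let $\tau\in(-1,1)$, $\delta=\min\{1+\tau,1-\tau\}$, $h(x)=\dfrac{f(\tau+x)-f(\tau-x)}{x}$, and $$D_{1,f}=\max_{|x|\le 1}|f'(x)|.$$ Let $h^{[\varepsilon]}(x)$ denote the value of $h$ at $x$ computed in floating point arithmetic of precision $\varepsilon$ (see context). Then for all $x$ with $0<|x|\le\delta$, $$\big|h^{[\varepsilon]}(x)-h(x)\big|\;\lesssim\;\frac{4\,\varepsilon\,D_{1,f}}{|x|}+4\,\varepsilon\,D_{1,f}.$$
   Context: Notation: $a\approx b$ means $a=b\,(1+O(\varepsilon))$, and $a\lesssim b$ means $a<b$ or $a\approx b$; here $O(\varepsilon)$ is as $\varepsilon\to0^+$, uniformly in all other quantities. $D_{1,f}$ is the maximum (supremum) of $|f'|$ on $[-1,1]$, assumed finite. Floating point model: the values of $f$ are assumed to be computed exactly, but $x$ and $\tau$ need not be exactly representable. The computed value is $$h^{[\varepsilon]}(x)=\frac{f\big((\tau(1+\gamma_1)+x(1+\gamma_2))(1+\gamma_3)\big)-f\big((\tau(1+\gamma_1)-x(1+\gamma_2))(1+\gamma_4)\big)}{x(1+\gamma_5)},$$ where $\gamma_1,\dots,\gamma_5$ are arbitrary real numbers (possibly depending on $x$, $\tau$, $\varepsilon$) with $|\gamma_1|,|\gamma_2|,|\gamma_3|,|\gamma_4|\le\varepsilon$ and $|\gamma_5|\lesssim 2\varepsilon$. The perturbed arguments at which $f$ is evaluated are understood to lie in the domain $[-1,1]$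 of $f$. *)

(* Defs.v *)
From Stdlib Require Import Reals.
Open Scope R_scope.

Definition unit_itv (t : R) : Prop := -1 <= t <= 1.

(* [f] is any total extension of a function on [-1,1]: [D_in] takes difference
   quotients inside [unit_itv] only, so derivatives at -1 and 1 are one-sided. *)
Definition derivative_on_unit_itv (f f' : R -> R) : Prop :=
  forall t : R, unit_itv t -> D_in f f' unit_itv t.

(* D = sup of |f'| over [-1,1]; a real D satisfying this exists exactly when
   f' is bounded there. *)
Definition is_D1 (f' : R -> R) (D : R) : Prop :=
  is_lub (fun y : R => exists t : R, unit_itv t /\ y = Rabs (f' t)) D.

(* a = b (1 + O(eps)), where C is the constant implied by the O. Uniformity is
   expressed by quantifying C before every other quantity. *)
Definition approx (C eps a b : R) : Prop :=
  exists r : R, Rabs r <= C * eps /\ a = b * (1 + r).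

Definition lesssim (C eps a b : R) : Prop :=
  a < b \/ approx C eps a b.

Definition delta (tau : R) : R := Rmin (1 + tau) (1 - tau).

Definition h (f : R -> R) (tau x : R) : R := (f (tau + x) - f (tau - x)) / x.

(* g1, g2: relative errors from representing tau and x; g3, g4: from rounding
   the sum and the difference; g5: total relative error of the remaining
   operations and of the denominator x, gathered in the divisor. *)
Definition fl_arg_plus (tau x g1 g2 g3 : R) : R :=
  (tau * (1 + g1) + x * (1 + g2)) * (1 + g3).

Definition fl_arg_minus (tau x g1 g2 g4 : R) : R :=
  (tau * (1 + g1) - x * (1 + g2)) * (1 + g4).

Definition h_fl (f : R -> R) (tau x g1 g2 g3 g4 g5 : R) : R :=
  (f (fl_arg_plus tau x g1 g2 g3) - f (fl_arg_minus tau x g1 g2 g4))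
    / (x * (1 + g5)).

(* Main.v *)
From Coquelicot Require Import Rcomplements Hierarchy Derive.
From Stdlib Require Import Lra.
Require Import Defs.
From Stdlib Require Import Reals.
Open Scope R_scope.

(** By the mean value theorem, [f] is [D]-Lipschitz on [[-1,1]].  Since
    [Rabs x <= delta tau] means [Rabs tau + Rabs x <= 1], each of the two
    arguments of [f] is perturbed by at most [eps] through the errors of [tau]
    and [x], and by at most [eps * (1 + eps)] through the rounding of the sum,
    so the numerator moves by at most [D * (4 * eps + 2 * eps ^ 2)]
    ([fl_arg_plus_error], [fl_arg_minus_error]).  Dividing by
    [x * (1 + g5)] instead of [x] turns this into the term
    [4 * eps * D / Rabs x], and moves the exact quotient, bounded by [2 * D]
    because the exact arguments are [2 * x] apart, by a relative error of about
    [2 * eps], which is the term [4 * eps * D] ([quotient_perturbation]).  All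
    that remains is of second order in [eps], with constants depending on [K]
    alone. *)

(** The sign of [C] is arbitrary; taking [Rabs C] also covers the case [a < b],
    where the slack [C * eps] has to be nonnegative. *)
Lemma lesssim_le (C eps a b : R) :
  0 <= eps -> 0 <= b -> lesssim C eps a b -> a <= b * (1 + Rabs C * eps).
Proof.
intros Heps Hb Hab.
assert (HC : 0 <= Rabs C * eps) by (apply Rmult_le_pos; [apply Rabs_pos | lra]).
destruct Hab as [Hlt | [r [Hr ->]]].
- nra.
- apply Rmult_le_compat_l; [exact Hb|].
  pose proof (Rle_abs r).
  pose proof (Rmult_le_compat_r eps _ _ Heps (Rle_abs C)).
  lra.
Qed.

(** Either [a < b], or [a / b] lies between [1] and [1 + C * eps]; when [b = 0]
    the quotient is meaningless, but then [a = 0] too. *)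
Lemma le_lesssim (C eps a b : R) :
  0 <= C * eps -> 0 <= a -> 0 <= b -> a <= b * (1 + C * eps) ->
  lesssim C eps a b.
Proof.
intros HC Ha Hb Hab.
destruct (Rlt_or_le a b) as [Hlt | Hle]; [now left|].
right; destruct (Req_dec b 0) as [Hb0 | Hb0].
- exists 0; rewrite Rabs_R0; split; [exact HC|].
  rewrite Hb0 in *; lra.
- exists (a / b - 1); split; [|now field].
  assert (H1 : 1 <= a / b) by (apply Rle_div_r; lra).
  assert (H2 : a / b <= 1 + C * eps) by (apply Rle_div_l; lra).
  rewrite Rabs_pos_eq; lra.
Qed.

Definition clamp (t : R) : R := Rmax (-1) (Rmin 1 t).

Lemma clamp_unit_itv (t : R) : unit_itv (clamp t).
Proof.
unfold unit_itv, clamp, Rmax, Rmin.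
destruct (Rle_dec 1 t); destruct (Rle_dec _ _); lra.
Qed.

Lemma clamp_id (t : R) : unit_itv t -> clamp t = t.
Proof.
unfold unit_itv, clamp, Rmax, Rmin; intros Ht.
destruct (Rle_dec 1 t); destruct (Rle_dec _ _); lra.
Qed.

Lemma clamp_contract (s t : R) : Rabs (clamp s - clamp t) <= Rabs (s - t).
Proof.
unfold clamp, Rmax, Rmin.
destruct (Rle_dec 1 s); destruct (Rle_dec 1 t);
  repeat destruct (Rle_dec _ _); unfold Rabs; repeat destruct (Rcase_abs _); lra.
Qed.

(** Nothing is known about [f] outside [[-1,1]], so [f] itself may be
    discontinuous at the endpoints.  Composing with [clamp] replaces it there by
    the constant continuation, which only sees the one-sided behaviour. *)
Lemma continuity_pt_clamp (f f' : R -> R) (t : R) :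
  derivative_on_unit_itv f f' -> unit_itv t ->
  continuity_pt (fun s => f (clamp s)) t.
Proof.
intros Hf Ht e He.
destruct (cont_deriv _ _ _ _ (Hf t Ht) e He) as [d [Hd Hlim]].
exists d; split; [exact Hd|].
simpl in *; unfold R_dist in *; intros s [_ Hst].
rewrite (clamp_id t Ht).
destruct (Req_dec t (clamp s)) as [<- | Hne].
- rewrite Rminus_diag, Rabs_R0; exact He.
- apply Hlim; split.
  + split; [apply clamp_unit_itv | exact Hne].
  + apply Rle_lt_trans with (2 := Hst).
    rewrite <- (clamp_id t Ht) at 1; apply clamp_contract.
Qed.

Lemma is_derive_clamp (f f' : R -> R) (t : R) :
  derivative_on_unit_itv f f' -> -1 < t < 1 ->
  is_derive (fun s => f (clamp s)) t (f' t).
Proof.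
intros Hf Ht.
assert (Htu : unit_itv t) by (unfold unit_itv; lra).
apply is_derive_Reals; intros e He.
destruct (Hf t Htu e He) as [d [Hd Hlim]].
(* Increments this small keep [t + k] inside the interval. *)
assert (Hm : 0 < Rmin d (Rmin (1 + t) (1 - t)))
  by (repeat apply Rmin_glb_lt; lra).
exists (mkposreal _ Hm); simpl; intros k Hk0 Hk.
pose proof (Rmin_l d (Rmin (1 + t) (1 - t))).
pose proof (Rmin_r d (Rmin (1 + t) (1 - t))).
pose proof (Rmin_l (1 + t) (1 - t)); pose proof (Rmin_r (1 + t) (1 - t)).
assert (Hin : unit_itv (t + k))
  by (unfold unit_itv; split_Rabs; lra).
rewrite (clamp_id t Htu), (clamp_id _ Hin).
simpl in Hlim; unfold R_dist in Hlim.
specialize (Hlim (t + k)).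
replace (t + k - t) with k in Hlim by ring.
apply Hlim; split; [split; [exact Hin | lra] | lra].
Qed.

Lemma lipschitz_on_unit_itv (f f' : R -> R) (D u v : R) :
  derivative_on_unit_itv f f' ->
  (forall t, unit_itv t -> Rabs (f' t) <= D) ->
  unit_itv u -> unit_itv v ->
  Rabs (f u - f v) <= D * Rabs (u - v).
Proof.
intros Hf HD Hu Hv.
assert (Hmin : -1 <= Rmin v u) by (apply Rmin_glb; [apply Hv | apply Hu]).
assert (Hmax : Rmax v u <= 1) by (apply Rmax_lub; [apply Hv | apply Hu]).
destruct (MVT_gen (fun s => f (clamp s)) v u f') as [c [Hc Heq]].
- intros t Ht; apply is_derive_clamp; [exact Hf | lra].
- intros t Ht; apply (continuity_pt_clamp f f'); [exact Hf | unfold unit_itv; lra].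
- rewrite (clamp_id u Hu), (clamp_id v Hv) in Heq.
  rewrite Heq, Rabs_mult.
  apply Rmult_le_compat_r; [apply Rabs_pos|].
  apply HD; unfold unit_itv; lra.
Qed.

Lemma fl_arg_plus_error (tau x eps g1 g2 g3 : R) :
  Rabs tau + Rabs x <= 1 ->
  Rabs g1 <= eps -> Rabs g2 <= eps -> Rabs g3 <= eps ->
  Rabs (fl_arg_plus tau x g1 g2 g3 - (tau + x)) <= 2 * eps + eps * eps.
Proof.
intros Htx H1 H2 H3.
pose proof (Rabs_pos tau); pose proof (Rabs_pos x).
pose proof (Rabs_pos g1); pose proof (Rabs_pos g2); pose proof (Rabs_pos g3).
(* [e] is the error inherited from the representation of [tau] and [x]. *)
set (e := tau * g1 + x * g2).
assert (He : Rabs e <= eps).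
{ unfold e; eapply Rle_trans; [apply Rabs_triang|].
  rewrite !Rabs_mult; nra. }
assert (Hs : Rabs (tau + x + e) <= 1 + eps).
{ eapply Rle_trans; [apply Rabs_triang|].
  pose proof (Rabs_triang tau x); lra. }
replace (fl_arg_plus tau x g1 g2 g3 - (tau + x))
  with (e + (tau + x + e) * g3) by (unfold fl_arg_plus, e; ring).
eapply Rle_trans; [apply Rabs_triang|].
rewrite Rabs_mult.
pose proof (Rabs_pos (tau + x + e)); nra.
Qed.

Lemma fl_arg_minus_error (tau x eps g1 g2 g4 : R) :
  Rabs tau + Rabs x <= 1 ->
  Rabs g1 <= eps -> Rabs g2 <= eps -> Rabs g4 <= eps ->
  Rabs (fl_arg_minus tau x g1 g2 g4 - (tau - x)) <= 2 * eps + eps * eps.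
Proof.
intros Htx H1 H2 H4.
replace (fl_arg_minus tau x g1 g2 g4) with (fl_arg_plus tau (- x) g1 g2 g4)
  by (unfold fl_arg_minus, fl_arg_plus; ring).
apply fl_arg_plus_error; rewrite ?Rabs_Ropp; assumption.
Qed.

(** The error splits as [(N' - N) / (x (1 + g)) - (N / x) (g / (1 + g))]. *)
Lemma quotient_perturbation (N N' x g : R) :
  x <> 0 -> Rabs g < 1 ->
  Rabs (N' / (x * (1 + g)) - N / x)
    <= (Rabs (N' - N) / Rabs x + Rabs (N / x) * Rabs g) / (1 - Rabs g).
Proof.
intros Hx Hg.
assert (Hg1 : 0 < 1 - Rabs g <= Rabs (1 + g)) by (split_Rabs; lra).
assert (Hg0 : 1 + g <> 0) by (split_Rabs; lra).
replace (N' / (x * (1 + g)) - N / x)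
  with (((N' - N) / x - N / x * g) / (1 + g)) by (field; tauto).
rewrite Rabs_div by exact Hg0.
apply Rmult_le_compat.
- apply Rabs_pos.
- left; apply Rinv_0_lt_compat; lra.
- eapply Rle_trans; [apply Rabs_triang|].
  rewrite Rabs_Ropp, Rabs_mult, <- Rabs_div by exact Hx; lra.
- apply Rinv_le_contravar; apply Hg1.
Qed.

(** The first-order terms are [4 * eps * p] and [4 * eps * q], where [p] stands
    for [D / Rabs x] and [q] for [D]; the smallness assumptions give
    [1 / (1 - g) <= 1 + 5 * eps]. *)
Lemma second_order_bound (k eps p q g : R) :
  0 <= k -> 0 < eps -> eps <= 1 / 8 -> k * eps <= 1 / 8 -> 0 <= p -> 0 <= q ->
  0 <= g -> g <= 2 * eps * (1 + k * eps) ->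
  (p * (4 * eps + 2 * (eps * eps)) + 2 * q * g) / (1 - g)
    <= (4 * eps * p + 4 * eps * q) * (1 + (6 + 2 * k) * eps).
Proof.
intros Hk He He8 Hke Hp Hq Hg Hgle.
assert (Hg2 : g <= 9 / 4 * eps) by nra.
assert (Hinv : 1 <= (1 + 5 * eps) * (1 - g)) by nra.
apply Rle_div_l; [lra|].
apply Rle_trans with
  ((p * (4 * eps + 2 * (eps * eps)) + 2 * q * g) * ((1 + 5 * eps) * (1 - g))).
{ assert (0 <= p * (4 * eps + 2 * (eps * eps)) + 2 * q * g); [|nra].
  apply Rplus_le_le_0_compat; repeat apply Rmult_le_pos; nra. }
rewrite <- Rmult_assoc; apply Rmult_le_compat_r; [lra|].
assert (Hpp : (4 * eps + 2 * (eps * eps)) * (1 + 5 * eps)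
              <= 4 * eps * (1 + (6 + 2 * k) * eps)).
{ replace (4 * eps + 2 * (eps * eps)) with (4 * eps * (1 + eps / 2)) by field.
  rewrite Rmult_assoc; apply Rmult_le_compat_l; nra. }
assert (Hqq : 2 * g * (1 + 5 * eps) <= 4 * eps * (1 + (6 + 2 * k) * eps)).
{ apply Rle_trans with (4 * eps * ((1 + k * eps) * (1 + 5 * eps))); [nra|].
  apply Rmult_le_compat_l; nra. }
pose proof (Rmult_le_compat_l p _ _ Hp Hpp).
pose proof (Rmult_le_compat_l q _ _ Hq Hqq).
lra.
Qed.

Theorem lemma1 :
  forall K : R,
  exists C eps0 : R, 0 < eps0 /\
  forall (f f' : R -> R) (D tau x eps g1 g2 g3 g4 g5 : R),
    derivative_on_unit_itv f f' ->
    is_D1 f' D ->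
    -1 < tau < 1 ->
    0 < Rabs x <= delta tau ->
    0 < eps < eps0 ->
    Rabs g1 <= eps -> Rabs g2 <= eps -> Rabs g3 <= eps -> Rabs g4 <= eps ->
    lesssim K eps (Rabs g5) (2 * eps) ->
    unit_itv (fl_arg_plus tau x g1 g2 g3) ->
    unit_itv (fl_arg_minus tau x g1 g2 g4) ->
    lesssim C eps
      (Rabs (h_fl f tau x g1 g2 g3 g4 g5 - h f tau x))
      (4 * eps * D / Rabs x + 4 * eps * D).
Proof.
intros K; pose proof (Rabs_pos K) as HK.
(* This [eps0] makes both [eps] and [Rabs K * eps] at most [1 / 8]. *)
exists (6 + 2 * Rabs K), (/ (8 * (1 + Rabs K))).
split; [apply Rinv_0_lt_compat; lra|].
intros f f' D tau x eps g1 g2 g3 g4 g5 Hf [HDub _] _ [Hx0 Hxd] [He He0]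
  H1 H2 H3 H4 H5 HA HB.
assert (HD : forall t, unit_itv t -> Rabs (f' t) <= D)
  by (intros t Ht; apply HDub; exists t; auto).
assert (HD0 : 0 <= D).
{ apply Rle_trans with (1 := Rabs_pos (f' 0)); apply HD; unfold unit_itv; lra. }
assert (Hsmall : eps * (8 * (1 + Rabs K)) < 1).
{ apply Rlt_div_r; [lra|]; unfold Rdiv; lra. }
assert (Hxne : x <> 0) by (intros ->; rewrite Rabs_R0 in Hx0; lra).
assert (Htx : Rabs tau + Rabs x <= 1).
{ unfold delta in Hxd.
  pose proof (Rmin_l (1 + tau) (1 - tau)); pose proof (Rmin_r (1 + tau) (1 - tau)).
  unfold Rabs at 1; destruct (Rcase_abs tau); lra. }
assert (Ha : unit_itv (tau + x)) by (unfold unit_itv; split_Rabs; lra).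
assert (Hb : unit_itv (tau - x)) by (unfold unit_itv; split_Rabs; lra).
apply lesssim_le in H5; [|lra|lra].
pose proof (Rabs_pos g5) as Hg5.
assert (Hg51 : Rabs g5 < 1) by nra.
set (A := fl_arg_plus tau x g1 g2 g3) in *.
set (B := fl_arg_minus tau x g1 g2 g4) in *.
assert (Hnum : Rabs ((f A - f B) - (f (tau + x) - f (tau - x)))
               <= D * (4 * eps + 2 * (eps * eps))).
{ replace ((f A - f B) - (f (tau + x) - f (tau - x)))
    with ((f A - f (tau + x)) + - (f B - f (tau - x))) by ring.
  eapply Rle_trans; [apply Rabs_triang|]; rewrite Rabs_Ropp.
  pose proof (lipschitz_on_unit_itv f f' D A (tau + x) Hf HD HA Ha) as LA.
  pose proof (lipschitz_on_unit_itv f f' D B (tau - x) Hf HD HB Hb) as LB.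
  pose proof (Rmult_le_compat_l D _ _ HD0
    (fl_arg_plus_error tau x eps g1 g2 g3 Htx H1 H2 H3)) as EA.
  pose proof (Rmult_le_compat_l D _ _ HD0
    (fl_arg_minus_error tau x eps g1 g2 g4 Htx H1 H2 H4)) as EB.
  fold A in EA; fold B in EB; lra. }
assert (Hh : Rabs ((f (tau + x) - f (tau - x)) / x) <= 2 * D).
{ rewrite Rabs_div by exact Hxne; apply Rle_div_l; [exact Hx0|].
  pose proof (lipschitz_on_unit_itv f f' D _ _ Hf HD Ha Hb) as L.
  replace (tau + x - (tau - x)) with (2 * x) in L by ring.
  rewrite Rabs_mult, (Rabs_pos_eq 2) in L; lra. }
assert (Hp : 0 <= D / Rabs x) by (apply Rdiv_le_0_compat; assumption).
replace (4 * eps * D / Rabs x) with (4 * eps * (D / Rabs x)) by (field; lra).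
apply le_lesssim; [nra | apply Rabs_pos | nra |].
eapply Rle_trans; [apply quotient_perturbation; assumption|].
eapply Rle_trans; [|apply (second_order_bound (Rabs K) eps _ _ (Rabs g5)); nra].
apply Rmult_le_compat_r; [left; apply Rinv_0_lt_compat; lra|].
apply Rplus_le_compat.
- replace (D / Rabs x * (4 * eps + 2 * (eps * eps)))
    with (D * (4 * eps + 2 * (eps * eps)) / Rabs x) by (field; lra).
  apply Rmult_le_compat_r; [left; apply Rinv_0_lt_compat; exact Hx0 | exact Hnum].
- apply Rmult_le_compat_r; [exact Hg5 | exact Hh].
Qed.
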